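(* Assume that $\delta:H\to\mathbb R^p$ is concave and that each column map $\Psi_{:,k}(\cdot):H\to\mathbb R^p$, $k=1,\dots,m$, is concave, convex, or affine on $H$. If there exists a common input $u\in\mathcal U\cap\mathcal S(\Psi)$ with $\Psi(x^j)u+\delta(x^j)\ge 0$ for all $j=1,\dots,N$, then $u$ satisfies $\Psi(x)u+\delta(x)\ge 0$ for all $x\in H$.
   Context: Setting. Consider the control-affine system $\dot x=f(x)+g(x)u$ with $x\in\mathcal X\subseteq\mathbb R^n$, $u\in\mathcal U\subseteq\mathbb R^m$, where $f:\mathbb R^n\to\mathbb R^n$ and $g:\mathbb R^n\to\mathbb R^{n\times m}$ are locally Lipschitz and $\mathcal U$ is nonempty, compact and convex. Let $h_1,\dots,h_p:\mathcal X\to\mathbb R$ be $C^1$ and let $\alpha_1,\dots,\alpha_p$ be extended class-$\mathcal K_\infty$ functions (continuous, strictly increasing bijections $\mathbb R\to\mathbb R$ with $\alpha_i(0)=0$). With $\nabla h_i(x)$ the gradient as a row vector, put $L_fh_i(x)=\nabla h_i(x)f(x)\in\mathbb R$ and $L_gh_i(x)=\nabla h_i(x)g(x)\in\mathbb R^{1\times m}$. Let $\Psi(x)\in\mathbb R^{p\times m}$ be the matrix whose $i$th row is $L_gh_i(x)$, and let $\delta(x)\in\mathbb R^p$ have entries $\delta_i(x)=L_fh_i(x)+\alpha_i(h_i(x))$. The stacked control barrier function inequalities at $x$ are $\Psi(x)u+\delta(x)\ge 0$. Points $x^1,\dots,x^N\in\mathcal X$ (''vertices'') are given with convex hull $H=\mathrm{co}\{x^1,\dots,x^N\}\subseteq\mathcal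 X$. Conventions. Vector inequalities are componentwise; concavity/convexity of vector-valued maps is componentwise. $\Psi_{:,k}$ is the $k$th column of $\Psi$. When every column map $\Psi_{:,k}(\cdot)$ is concave, convex or affine on $H$, define for each $k$: $\mathcal S_k(\Psi)=\mathbb R$ if $\Psi_{:,k}$ is affine on $H$ (this case takes precedence); otherwise $\mathcal S_k(\Psi)=[0,\infty)$ if $\Psi_{:,k}$ is concave on $H$ and $\mathcal S_k(\Psi)=(-\infty,0]$ if $\Psi_{:,k}$ is convex on $H$. The sign-aligned cone is $\mathcal S(\Psi)=\{u\in\mathbb R^m:\ u_k\in\mathcal S_k(\Psi)\text{ for all }k\}$. *)

(* Defs.v *)
From HB Require Import structures.
From mathcomp Require Import all_boot all_order all_algebra.
From mathcomp Require Import all_classical all_reals all_analysis.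
Set Implicit Arguments.
Unset Strict Implicit.
Unset Printing Implicit Defensive.
Import Order.TTheory GRing.Theory Num.Theory.
Import numFieldNormedType.Exports.
Local Open Scope classical_set_scope.
Local Open Scope ring_scope.
Local Open Scope convex_scope.

Definition gradient (R : realType) (n : nat) (h : 'cV[R]_n -> R)
    (x : 'cV[R]_n) : 'rV[R]_n :=
  \row_i 'D_(delta_mx i 0) h x.

(* [X] need not be open: C^1 on [X] means C^1 on an open neighbourhood of [X],
   where the total function [h] is the extension whose gradient is taken. *)
Definition C1_on (R : realType) (n : nat) (X : set 'cV[R]_n)
    (h : 'cV[R]_n -> R) : Prop :=
  exists O : set 'cV[R]_n, [/\ open O, X `<=` O,
    forall x, O x -> differentiable h x &
    forall x, O x -> {for x, continuous (gradient h)}].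

Definition ext_class_Kinf (R : realType) (a : R -> R) : Prop :=
  [/\ continuous a, {homo a : s t / s < t}, bijective a & a 0 = 0].

Definition lie_f (R : realType) (n : nat) (f : 'cV[R]_n -> 'cV[R]_n)
    (h : 'cV[R]_n -> R) (x : 'cV[R]_n) : R :=
  (gradient h x *m f x) 0 0.

Definition lie_g (R : realType) (n m : nat) (g : 'cV[R]_n -> 'M[R]_(n, m))
    (h : 'cV[R]_n -> R) (x : 'cV[R]_n) : 'rV[R]_m :=
  gradient h x *m g x.

Definition Psi (R : realType) (n m p : nat) (g : 'cV[R]_n -> 'M[R]_(n, m))
    (h : 'I_p -> 'cV[R]_n -> R) (x : 'cV[R]_n) : 'M[R]_(p, m) :=
  \matrix_(i < p) lie_g g (h i) x.

Definition delta (R : realType) (n p : nat) (f : 'cV[R]_n -> 'cV[R]_n)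
    (h : 'I_p -> 'cV[R]_n -> R) (alpha : 'I_p -> R -> R)
    (x : 'cV[R]_n) : 'cV[R]_p :=
  \col_i (lie_f f (h i) x + alpha i (h i x)).

Definition convex_hull (R : realType) (n N : nat) (v : 'I_N -> 'cV[R]_n) :
    set 'cV[R]_n :=
  [set y | exists l : 'I_N -> R,
    [/\ forall j, 0 <= l j, \sum_j l j = 1 & y = \sum_j l j *: v j]].

Definition concave_function (R : realType) (E : lmodType R)
    (E' := convex_lmodType E) (D : set E') (f : E' -> R^o) : Prop :=
  forall t : {i01 R},
    {in D &, forall x y : E', (f x <| t |> f y : R) <= f (x <| t |> y)}.

Definition affine_function (R : realType) (E : lmodType R)
    (E' := convex_lmodType E) (D : set E') (f : E' -> R^o) : Prop :=
  forall t : {i01 R},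
    {in D &, forall x y : E', f (x <| t |> y) = f x <| t |> f y}.

Definition convex_vec (R : realType) (n p : nat) (D : set 'cV[R]_n)
    (F : 'cV[R]_n -> 'cV[R]_p) : Prop :=
  forall i, convex_function (D : set (convex_lmodType _)) (fun x => F x i 0).

Definition concave_vec (R : realType) (n p : nat) (D : set 'cV[R]_n)
    (F : 'cV[R]_n -> 'cV[R]_p) : Prop :=
  forall i, concave_function (D : set (convex_lmodType _)) (fun x => F x i 0).

Definition affine_vec (R : realType) (n p : nat) (D : set 'cV[R]_n)
    (F : 'cV[R]_n -> 'cV[R]_p) : Prop :=
  forall i, affine_function (D : set (convex_lmodType _)) (fun x => F x i 0).

(* The last branch is a junk value, reached only when the column is neither
   affine, concave nor convex on [H]. *)
Definition sign_set (R : realType) (n m p : nat) (H : set 'cV[R]_n)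
    (P : 'cV[R]_n -> 'M[R]_(p, m)) (k : 'I_m) : set R :=
  if `[< affine_vec H (fun x => col k (P x)) >] then setT
  else if `[< concave_vec H (fun x => col k (P x)) >] then [set s | 0 <= s]
  else if `[< convex_vec H (fun x => col k (P x)) >] then [set s | s <= 0]
  else set0.

Definition sign_cone (R : realType) (n m p : nat) (H : set 'cV[R]_n)
    (P : 'cV[R]_n -> 'M[R]_(p, m)) : set 'cV[R]_m :=
  [set u | forall k, sign_set H P k (u k 0)].

Definition col_ge0 (R : realType) (p : nat) (v : 'cV[R]_p) : Prop :=
  forall i, 0 <= v i 0.

(* Main.v *)
(** Sign alignment makes every scalar component of [Psi x *m u + delta x] a
    sum of concave functions of [x] on the hull [H]: a concave column is
    multiplied by a nonnegative input, a convex one by a nonpositive input.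
    The set where a concave component is nonnegative is a convex set
    containing the vertices, hence contains [H]. *)
Require Import Defs.
From HB Require Import structures.
From mathcomp Require Import all_boot all_order all_algebra.
From mathcomp Require Import all_classical all_reals all_analysis.
Set Implicit Arguments.
Unset Strict Implicit.
Unset Printing Implicit Defensive.
Import Order.TTheory GRing.Theory Num.Theory.
Import numFieldNormedType.Exports.
Local Open Scope classical_set_scope.
Local Open Scope ring_scope.

Section ConvexHull.
Context {R : realType} {n N : nat}.
Implicit Type v : 'I_N -> 'cV[R]_n.

Lemma convex_hull_vertex v j : convex_hull v (v j).
Proof.
exists (fun i => (i == j)%:R); split => [i||]; first exact: ler0n.
  by rewrite (bigD1 j)//= eqxx big1 ?addr0// => i /negPf ->.
rewrite (bigD1 j)//= eqxx scale1r big1 ?addr0// => i /negPf ->.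
by rewrite scale0r.
Qed.

(** Mixing two weight families with the same [t] keeps them nonnegative with sum 1. This makes the
    hull an admissible domain for a superlevel set. *)
Lemma convex_hull_convex v :
  convex_set (convex_hull v : set (convex_lmodType 'cV[R]_n)).
Proof.
move=> x y t; rewrite !inE => -[l [l0 l1 ->]] [k [k0 k1 ->]].
exists (fun j => t%:num * l j + (1 - t%:num) * k j); split.
- by move=> j; rewrite addr_ge0// mulr_ge0// subr_ge0 le1.
- by rewrite big_split/= -!mulr_sumr l1 k1 !mulr1 addrC subrK.
- rewrite /conv/= !scaler_sumr -big_split/=; apply: eq_bigr => j _.
  by rewrite [RHS]scalerDl -!scalerA.
Qed.

Lemma convex_hull_min v (S : set 'cV[R]_n) :
  convex_set (S : set (convex_lmodType 'cV[R]_n)) ->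
  (forall j, S (v j)) -> convex_hull v `<=` S.
Proof.
move=> cS Sv x [l [l0 l1 ->]].
(* With [N = 0] the weights would sum to 0, not 1. The vertex [v j0] supplies the point of [S] that
   represents the empty sum as [0 *: v j0]. *)
have [j0 _] : exists j : 'I_N, True.
  case: N v l Sv l0 l1 => [|k] v0 l' _ _ l1; last by exists ord0.
  by move: l1; rewrite big_ord0 => /esym/eqP; rewrite oner_eq0.
(* Partial sums have total weight other than 1, so the induction runs in the
   cone over [S], where no normalization is needed. *)
pose cone (a : R) (z : 'cV[R]_n) := 0 <= a /\ exists2 y, S y & z = a *: y.
suff [_ [y Sy ->]] : cone (\sum_j l j) (\sum_j l j *: v j).
  by rewrite l1 scale1r.
apply: (big_ind2 cone) => [|a y b z [a0 [y' Sy ->]] [b0 [z' Sz ->]]|j _].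
- by split=> //; exists (v j0); rewrite ?scale0r.
- split; first exact: addr_ge0.
  (* If [a + b = 0], both weights vanish and any point of [S] will do. *)
  have [ab0|ab0] := eqVneq (a + b) 0.
    exists y' => //; move/eqP: ab0; rewrite paddr_eq0// => /andP[/eqP -> /eqP ->].
    by rewrite addr0 !scale0r addr0.
  have ab_gt0 : 0 < a + b by rewrite lt_neqAle eq_sym ab0 addr_ge0.
  (* Otherwise the representative is the convex combination of [y'] and [z'] with weight
     [a / (a + b)]; scaling it by [a + b] gives back [a *: y' + b *: z']. *)
  have t0 : 0 <= a / (a + b) by rewrite divr_ge0// ltW.
  have t1 : a / (a + b) <= 1 by rewrite ler_pdivrMr// mul1r lerDl.
  have := cS y' z' (Itv01 t0 t1); rewrite !inE => /(_ Sy Sz) Syz.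
  eexists; first exact: Syz.
  rewrite /conv/= scalerDr !scalerA mulrBr mulr1 mulrC divfK//.
  by rewrite addrAC subrr add0r.
- by split=> //; exists (v j).
Qed.

End ConvexHull.

Section ConcaveFunction.
Context {R : realType} {E : lmodType R}.
Let E' := convex_lmodType E.
Implicit Types (D : set E') (f g : E' -> R^o).
Local Open Scope convex_scope.

Lemma concave_function_ext D f g :
  f =1 g -> concave_function D f -> concave_function D g.
Proof. by move=> /funext ->. Qed.

Lemma concave_functionD D f g : concave_function D f ->
  concave_function D g -> concave_function D (fun x => f x + g x).
Proof.
move=> cf cg t x y xD yD; apply: le_trans (lerD (cf t x y xD yD) (cg t x y xD yD)).
by rewrite !convRE !mulrDr addrACA.
Qed.

Lemma concave_function_sum (I : Type) (r : seq I) D (F : I -> E' -> R^o) :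
  (forall i, concave_function D (F i)) ->
  concave_function D (fun x => \sum_(i <- r) F i x).
Proof.
move=> cF; elim: r => [|i r IHr].
  apply: (@concave_function_ext D (fun=> 0)) => [x|t x y _ _].
    by rewrite big_nil.
  by rewrite convRE !mulr0 addr0.
apply: concave_function_ext (concave_functionD (cF i) IHr) => x.
by rewrite big_cons.
Qed.

Lemma concave_functionMr D f (c : R) : 0 <= c ->
  concave_function D f -> concave_function D (fun x => f x * c).
Proof.
move=> c0 cf t x y xD yD; apply: le_trans (ler_wpM2r c0 (cf t x y xD yD)).
by rewrite !convRE [leRHS]mulrDl !mulrA.
Qed.

(** A nonpositive factor reverses the convexity inequality. *)
Lemma convex_functionMr D f (c : R) : c <= 0 ->
  convex_function D f -> concave_function D (fun x => f x * c).
Proof.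
move=> c0 cf t x y xD yD; apply: le_trans (ler_wnM2r c0 (cf t x y xD yD)).
by rewrite !convRE [leRHS]mulrDl !mulrA.
Qed.

(** Equality survives multiplication by a scalar of either sign. *)
Lemma affine_functionMr D f (c : R) :
  affine_function D f -> concave_function D (fun x => f x * c).
Proof.
move=> af t x y xD yD; rewrite (af t x y xD yD).
by rewrite !convRE [leRHS]mulrDl !mulrA.
Qed.

(** Concavity holds only on [D], hence the intersection with [D]. *)
Lemma concave_function_superlevel D f (c : R) : convex_set D ->
  concave_function D f -> convex_set (D `&` [set x | c <= f x]).
Proof.
move=> cD cf x y t /set_mem[xD cx] /set_mem[yD cy]; apply/mem_set.
have xD' := mem_set xD; have yD' := mem_set yD.
split; first exact/set_mem/cD.
apply: le_trans (cf t x y xD' yD'); rewrite convRE.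
(* The bound [c] is split as [t * c + (1 - t) * c] and compared term by term. *)
rewrite -[leLHS]mul1r -[X in X * c](subrK t%:num) addrC mulrDl.
by rewrite lerD// ler_wpM2l// subr_ge0 le1.
Qed.

End ConcaveFunction.

(** Each branch of [sign_set] allows exactly the signs for which the matching product lemma applies;
    in the default branch, membership in [set0] is absurd. *)
Lemma sign_aligned_concave {R : realType} {n m p : nat} {H : set 'cV[R]_n}
    {P : 'cV[R]_n -> 'M[R]_(p, m)} (k : 'I_m) (c : R) (i : 'I_p) :
  sign_set H P k c ->
  concave_function (H : set (convex_lmodType _)) (fun x => P x i k * c).
Proof.
have colE : (fun x => P x i k) = (fun x => col k (P x) i 0).
  by apply/funext => x; rewrite mxE.
have {colE} -> : (fun x => P x i k * c) = (fun x => col k (P x) i 0 * c).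
  by apply/funext => x; rewrite mxE.
rewrite /sign_set; case: asboolP => [/(_ i) aP _|_].
  exact: affine_functionMr.
case: asboolP => [/(_ i) cP c0|_]; first exact: concave_functionMr.
by case: asboolP => [/(_ i) cP c0|//]; exact: convex_functionMr.
Qed.

Theorem theorem2 (R : realType) (n m p N : nat)
    (X : set 'cV[R]_n) (U : set 'cV[R]_m)
    (f : 'cV[R]_n -> 'cV[R]_n) (g : 'cV[R]_n -> 'M[R]_(n, m))
    (h : 'I_p -> 'cV[R]_n -> R) (alpha : 'I_p -> R -> R)
    (v : 'I_N -> 'cV[R]_n)
    (f_lip : [locally [lipschitz f x | x in setT]])
    (g_lip : [locally [lipschitz g x | x in setT]])
    (U_neq0 : U !=set0) (U_compact : compact U)
    (U_convex : convex_set (U : set (convex_lmodType 'cV[R]_m)))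
    (h_C1 : forall i, C1_on X (h i))
    (alpha_Kinf : forall i, ext_class_Kinf (alpha i))
    (v_X : forall j, X (v j)) (hull_X : convex_hull v `<=` X)
    (delta_concave : concave_vec (convex_hull v) (delta f h alpha))
    (Psi_columns : forall k : 'I_m,
      let Psi_k := fun x => col k (Psi g h x) in
      [\/ concave_vec (convex_hull v) Psi_k,
          convex_vec (convex_hull v) Psi_k |
          affine_vec (convex_hull v) Psi_k])
    (u : 'cV[R]_m) (u_US : (U `&` sign_cone (convex_hull v) (Psi g h)) u)
    (u_vertices : forall j,
      col_ge0 (Psi g h (v j) *m u + delta f h alpha (v j))) :
  forall x, convex_hull v x ->
    col_ge0 (Psi g h x *m u + delta f h alpha x).
Proof.
case: u_US => _ u_sign x Hx i.
(* Expanding the matrix product isolates one column and one input entry per summand, so that sign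
   alignment acts termwise. *)
pose F y := \sum_k Psi g h y i k * u k 0 + delta f h alpha y i 0.
have FE y : (Psi g h y *m u + delta f h alpha y) i 0 = F y.
  by rewrite mxE [X in X + _]mxE.
have cF : concave_function (convex_hull v : set (convex_lmodType _)) F.
  apply: concave_functionD; last exact: delta_concave.
  by apply: concave_function_sum => k; exact: sign_aligned_concave.
have cS := concave_function_superlevel (c := 0) (@convex_hull_convex _ _ _ v) cF.
have S_v j : (convex_hull v `&` [set y | 0 <= F y]) (v j).
  split; first exact: convex_hull_vertex.
  by rewrite /= -FE; exact: u_vertices.
by rewrite FE; have [] := convex_hull_min cS S_v Hx.
Qed.
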